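(* There exists a nontrivial uniform algebra $A$ such that the set $\exp A=\{\exp a : a\in A\}$ is dense in $A$.
   Context: All spaces are Hausdorff. For a compact space $X$, $C(X)$ is the algebra of continuous complex-valued functions on $X$ with the supremum norm. A uniform algebra $A$ on a compact space $X$ is a closed subalgebra of $C(X)$ that contains the constants and separates the points of $X$. It is trivial if $A=C(X)$ and nontrivial otherwise. *)

(* Defs.v *)
From HB Require Import structures.
From mathcomp Require Import all_boot all_order all_algebra.
From mathcomp Require Import all_classical all_reals all_analysis.
From mathcomp Require Import complex.
Import Order.TTheory GRing.Theory Num.Theory.
Import numFieldNormedType.Exports.

Set Implicit Arguments.
Unset Strict Implicit.
Unset Printing Implicit Defensive.

Local Open Scope classical_set_scope.
Local Open Scope ring_scope.
Local Open Scope complex_scope.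

HB.instance Definition _ (R : realType) := NormedModule.copy R[i] R[i]^o.

Definition cexp (R : realType) (z : R[i]) : R[i] :=
  let: x +i* y := z in (expR x * cos y) +i* (expR x * sin y).

(* C(X) as a subset of {uniform X -> R[i]}. On C(X), for X compact, the
   topology of uniform convergence is the one of the supremum norm, and C(X)
   is closed, so a subset of C(X) is closed in {uniform X -> R[i]} if and only
   if it is closed in C(X). *)
Definition cont_funs (R : realType) (X : topologicalType) :
  set {uniform X -> R[i]} := [set f | continuous (f : X -> R[i])].

Record uniform_algebra (R : realType) (X : topologicalType)
    (A : set {uniform X -> R[i]}) : Prop := UniformAlgebra {
  ualg_cont : A `<=` @cont_funs R X ;
  ualg_closed : closed A ;
  ualg_cst : forall c : R[i], A (cst c) ;
  ualg_add : forall f g, A f -> A g -> A (f \+ g) ;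
  ualg_scale : forall (c : R[i]) f, A f -> A (c \*o f) ;
  ualg_mul : forall f g, A f -> A g -> A (f \* g) ;
  ualg_sep : forall x y : X, x <> y -> exists2 f, A f & f x <> f y
}.

Definition nontrivial (R : realType) (X : topologicalType)
    (A : set {uniform X -> R[i]}) : Prop := A <> @cont_funs R X.

Definition exp_set (R : realType) (X : topologicalType)
    (A : set {uniform X -> R[i]}) : set {uniform X -> R[i]} :=
  [set (fun x => cexp (a x)) | a in A].

(* Main.v *)
Require Import Defs.
From HB Require Import structures.
From mathcomp Require Import all_boot all_order all_algebra.
From mathcomp Require Import all_classical all_reals all_analysis.
From mathcomp Require Import complex ring lra.
From mathcomp Require finmap.
Import Order.TTheory GRing.Theory Num.Theory.
Import numFieldNormedType.Exports.
Import Normc.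

(* Over the closed unit disc with coordinate z, adjoin one after the other new
   coordinates w_a, where a runs over a countable family of polynomials in z and
   in the coordinates already adjoined, subject to S_a exp(w_a) = a and
   |w_a| <= R_a, where S_a > |a|. The limit X is a compact subset of a product
   of discs, and A is the closure of the polynomials in z and the w_a. Every a
   that does not vanish at a fixed base point b over z = 0 is the exponential of
   w_a + log S_a, so exp A is dense in A.

   The function conj z is not in A. At each finite level a logarithm does not
   branch, so every point has a neighbourhood on which the coordinates are
   holomorphic functions of z. If |p - conj z| < 1/4 on a finite level, consider
     u = Re (1 - z p) - sum_a eps_a log |2 - w_a| + |z|^2 / 4.
   Since Re w_a <= 0, the logarithms are nonnegative and harmonic, and R_a is so
   large that eps_a log |2 - w_a| >= 1 where |w_a| = R_a. For a summable choice
   of eps_a one has u(b) >= 3/4, whereas u <= 1/2 where |z| = 1 and u <= 1/4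
   where some |w_a| = R_a. Hence u has an interior maximum, although it is
   strictly subharmonic in z. The gap 1/4 at the finite levels survives in the
   limit by compactness. *)

Set Implicit Arguments.
Unset Strict Implicit.
Unset Printing Implicit Defensive.

Local Open Scope classical_set_scope.
Local Open Scope ring_scope.
Local Open Scope complex_scope.

Local Notation Re := complex.Re.
Local Notation Im := complex.Im.

(** * Second-order Taylor bounds *)

Section RealTaylor.
Context {R : realType}.
Implicit Types x y : R.

(** The mean value theorem gives f x = [df c * x] with |c| <= |x|; the factor 1/(n+1) of a true
    integration is given up. Iterating it raises the order of vanishing at 0 one step at a time,
    which yields the Taylor estimates below. *)
Lemma norm_le_integrate (f df : R -> R) n (M : R) :
  (forall x, is_derive x 1 f (df x)) -> f 0 = 0 ->
  (forall x, `|x| <= 1 -> `|df x| <= M * `|x| ^+ n) ->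
  forall x, `|x| <= 1 -> `|f x| <= M * `|x| ^+ n.+1.
Proof.
move=> dfP f0 dfM x x1.
have cf a b : {within `[a, b], continuous f}.
  apply: continuous_subspaceT => z; apply/differentiable_continuous.
  by apply/derivable1_diffP; have [] := dfP z.
have M0 : 0 <= M.
  by have := dfM 1; rewrite normr1 lexx expr1n mulr1 => /(_ isT); apply: le_trans.
have key c : `|c| <= `|x| -> `|df c * x| <= M * `|x| ^+ n.+1.
  move=> cx; rewrite normrM exprSr mulrA ler_wpM2r//.
  apply: le_trans (dfM c (le_trans cx x1)) _.
  by rewrite ler_wpM2l// lerXn2r// nnegrE.
have [xneg|xpos|->] := ltgtP x 0; last first.
- by rewrite f0 !normr0 expr0n mulr0.
- have [c] := MVT_segment (ltW xpos) (fun z _ => dfP z) (cf _ _).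
  rewrite in_itv/= => /andP[c0 cx]; rewrite f0 !subr0 => ->; apply: key.
  by rewrite !ger0_norm// ltW.
- have [c] := MVT_segment (ltW xneg) (fun z _ => dfP z) (cf _ _).
  rewrite in_itv/= => /andP[cx c0]; rewrite f0 sub0r => fE.
  rewrite -normrN fE sub0r mulrN normrN; apply: key.
  by rewrite !ler0_norm ?lerN2// ltW.
Qed.

Lemma expR_taylor2 x : `|x| <= 1 -> `|expR x - 1 - x - x ^+ 2 / 2| <= 4 * `|x| ^+ 3.
Proof.
move: x; apply: (norm_le_integrate (df := (fun x => expR x - 1 - x)) (n := 2)).
- move=> x; apply: is_derive_eq. rewrite /GRing.scale/=. lra.
- by rewrite expR0; lra.
apply: (norm_le_integrate (df := (fun x => expR x - 1)) (n := 1)).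
- move=> x; apply: is_derive_eq. lra.
- by rewrite expR0; lra.
apply: (norm_le_integrate (df := expR) (n := 0)).
- move=> x; apply: is_derive_eq. lra.
- by rewrite expR0; lra.
move=> x; rewrite expr0 mulr1 ler_norml => /andP[_ x1].
(* exp (x/2) <= 2 because exp (-x/2) >= 1 - x/2 >= 1/2; squaring gives the constant 4. *)
rewrite gtr0_norm ?expR_gt0// (_ : x = x / 2 + x / 2); last by lra.
rewrite expRD; have := expR_ge1Dx (- (x / 2)); rewrite expRN => e1.
have e0 : 0 < expR (x / 2) by exact: expR_gt0.
have e2 : expR (x / 2) <= 2.
  rewrite -[leRHS]invrK -[leLHS]invrK lef_pV2 ?posrE ?invr_gt0//; lra.
nra.
Qed.

Lemma sin_taylor2 x : `|x| <= 1 -> `|sin x - x| <= `|x| ^+ 3.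
Proof.
move=> x1; rewrite -[leRHS]mul1r; move: x x1.
apply: (norm_le_integrate (df := (fun x => cos x - 1)) (n := 2)).
- have := @sin0 R; lra.
apply: (norm_le_integrate (df := (fun x => - sin x)) (n := 1)).
- move=> x; apply: is_derive_eq. lra.
- by rewrite cos0; lra.
apply: (norm_le_integrate (df := (fun x => - cos x)) (n := 0)).
- have := @sin0 R; lra.
by move=> x _; rewrite normrN expr0 mulr1 cos_max.
Qed.

Lemma cos_taylor2 x : `|x| <= 1 -> `|cos x - 1 + x ^+ 2 / 2| <= `|x| ^+ 3.
Proof.
move=> x1; apply: (@le_trans _ _ (1 * `|x| ^+ 4)); last first.
  by rewrite mul1r exprS ler_piMl// exprn_ge0.
move: x x1; apply: (norm_le_integrate (df := (fun x => - sin x + x)) (n := 3)).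
- move=> x; apply: is_derive_eq. rewrite /GRing.scale/=. lra.
- by rewrite cos0; lra.
by move=> x x1; rewrite mul1r -normrN opprD opprK; apply: sin_taylor2.
Qed.

Lemma normr_atan_le x : `|atan x| <= `|x|.
Proof.
have cf a b : {within `[a, b], continuous (@atan R)}.
  by apply: continuous_subspaceT => z; apply: continuous_atan.
have d (z : R) : is_derive z 1 (@atan R) ((1 + z ^+ 2)^-1).
  exact: is_derive1_atan.
have key (a b : R) : a <= b -> `|atan b - atan a| <= `|b - a|.
  move=> ab; have [c _ ->] := MVT_segment ab (fun z _ => d z) (cf _ _).
  rewrite normrM ler_piMl// normrV ?unitfE ?gt_eqF ?ltr_pwDl ?sqr_ge0//.
  rewrite ger0_norm ?addr_ge0 ?sqr_ge0// invf_le1 ?ltr_pwDl ?sqr_ge0//.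
  by rewrite lerDl sqr_ge0.
have [x0|x0] := leP 0 x.
  by have := key _ _ x0; rewrite atan0 !subr0.
by have := key _ _ (ltW x0); rewrite atan0 !sub0r !normrN.
Qed.

End RealTaylor.

(** * The complex exponential and a local logarithm *)

Section ComplexExp.
Context {R : realType}.
Implicit Types (x y : R) (z w u d : R[i]).

Lemma normc_ge0 z : 0 <= normc z.
Proof. by case: z => a b /=; rewrite sqrtr_ge0. Qed.

Lemma ReD z w : Re (z + w) = Re z + Re w.
Proof. by move: z w => [a b] [c d]. Qed.

Lemma ImD z w : Im (z + w) = Im z + Im w.
Proof. by move: z w => [a b] [c d]. Qed.

Lemma ReN z : Re (- z) = - Re z.
Proof. by case: z. Qed.

Lemma ImN z : Im (- z) = - Im z.
Proof. by case: z. Qed.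

Lemma ReM z w : Re (z * w) = Re z * Re w - Im z * Im w.
Proof. by move: z w => [a b] [c d]. Qed.

Lemma ImM z w : Im (z * w) = Re z * Im w + Im z * Re w.
Proof. by move: z w => [a b] [c d]. Qed.

Lemma normr_Re_le z : `|Re z| <= normc z.
Proof.
case: z => a b /=; rewrite -sqrtr_sqr ler_sqrt ?addr_ge0 ?sqr_ge0//.
by rewrite lerDl sqr_ge0.
Qed.

Lemma normr_Im_le z : `|Im z| <= normc z.
Proof.
case: z => a b /=; rewrite -sqrtr_sqr ler_sqrt ?addr_ge0 ?sqr_ge0//.
by rewrite lerDr sqr_ge0.
Qed.

Lemma normc_real x : normc x%:C = `|x|.
Proof. by rewrite /= expr0n addr0 sqrtr_sqr. Qed.

Lemma normc2 : normc (2 : R[i]) = 2.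
Proof. by rewrite (_ : 2 = 2%:C) ?normc_real ?ger0_norm// rmorph_nat. Qed.

Lemma normc_le_ReIm z : normc z <= `|Re z| + `|Im z|.
Proof.
rewrite [in leLHS](complexE z); apply: le_trans (le_normcD _ _) _.
rewrite normcM !normc_real (_ : normc 'i%C = 1) ?mul1r//=.
by rewrite expr0n expr1n add0r sqrtr1.
Qed.

Lemma normc_eq0 z : (normc z == 0) = (z == 0).
Proof. by apply/eqP/eqP => [/eq0_normc //|->]; exact: normc0. Qed.

Lemma normc_gt0 z : (0 < normc z) = (z != 0).
Proof. by rewrite lt_def normc_ge0 andbT normc_eq0. Qed.

Lemma normcB z w : normc (z - w) = normc (w - z).
Proof. by rewrite -normcN opprB. Qed.

Lemma normcX z n : normc (z ^+ n) = normc z ^+ n.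
Proof. by elim: n => [|n IH]; rewrite ?normc1// !exprS normcM IH. Qed.

Lemma cexpD z w : cexp (z + w) = cexp z * cexp w.
Proof.
case: z => a b; case: w => c d; apply/eqP; rewrite eq_complex /=.
by rewrite expRD sinD cosD; apply/andP; split; apply/eqP; ring.
Qed.

Lemma cexp_real x : cexp x%:C = (expR x)%:C.
Proof. by rewrite /cexp /= cos0 sin0 mulr1 mulr0. Qed.

Lemma normc_cexp z : normc (cexp z) = expR (Re z).
Proof.
case: z => a b /=; rewrite !exprMn -mulrDr cos2Dsin2 mulr1.
by rewrite sqrtr_sqr gtr0_norm ?expR_gt0.
Qed.

Lemma cexp_surj z : z != 0 -> exists w, cexp w = z.
Proof.
move=> z0; have r0 : 0 < normc z by rewrite normc_gt0.
pose c := Re z / normc z; pose s := Im z / normc z.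
have cs : c ^+ 2 + s ^+ 2 = 1.
  rewrite /c /s !exprMn -mulrDl exprVn (_ : Re z ^+ 2 + Im z ^+ 2 = normc z ^+ 2).
    by rewrite divff ?expf_eq0 ?gt_eqF.
  by case: (z) => a b /=; rewrite sqr_sqrtr ?addr_ge0 ?sqr_ge0.
have c1 : -1 <= c <= 1 by apply/andP; split; nra.
(* [acos c] has nonnegative sine, so the angle is [acos c] or its opposite according to the sign of
   [s]. *)
have [t [tc ts]] : exists t, cos t = c /\ sin t = s.
  have cK : cos (acos c) = c by apply: acosK; rewrite in_itv.
  have sK : sin (acos c) = `|s|.
    by rewrite sin_acos// (_ : 1 - c ^+ 2 = s ^+ 2) ?sqrtr_sqr//; lra.
  have [s0|s0] := leP 0 s.
    by exists (acos c); rewrite sK ger0_norm.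
  by exists (- acos c); rewrite cosN sinN sK ltr0_norm// opprK.
exists (ln (normc z) +i* t); rewrite /cexp lnK ?posrE// tc ts /c /s.
by rewrite !(mulrC (normc z)) !divfK ?gt_eqF//; case: (z).
Qed.

Lemma cexp_taylor2 d : normc d <= 1 ->
  normc (cexp d - 1 - d - d ^+ 2 / 2) <= 16 * normc d ^+ 3.
Proof.
move=> d1; have xr := normr_Re_le d; have yr := normr_Im_le d.
have := expR_taylor2 (le_trans xr d1); have := sin_taylor2 (le_trans yr d1).
have := cos_taylor2 (le_trans yr d1).
case: d xr yr d1 => x y xr yr; set r := normc _ in xr yr *.
rewrite [Re _]/= [Im _]/= in xr yr * => r1.
have r0 : 0 <= r by exact: normc_ge0.
set q := cos y - 1 + _; set s := sin y - y; set p := expR x - 1 - x - _ => qP sP pP.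
have r3 k : 0 <= k <= r -> k ^+ 3 <= r ^+ 3.
  by move=> /andP[k0 kr]; rewrite lerXn2r// nnegrE// (le_trans k0).
have {}qP : `|q| <= r ^+ 3 by apply: le_trans qP _; rewrite r3// normr_ge0.
have {}sP : `|s| <= r ^+ 3 by apply: le_trans sP _; rewrite r3// normr_ge0.
have {}pP : `|p| <= 4 * r ^+ 3.
  by apply: le_trans pP _; rewrite ler_wpM2l// r3// normr_ge0.
have ecos : cos y = 1 - y ^+ 2 / 2 + q by rewrite /q; lra.
have esin : sin y = y + s by rewrite /s; lra.
have eexp : expR x = 1 + x + x ^+ 2 / 2 + p by rewrite /p; lra.
have bound (a b c e : R) : `|a| <= c -> `|b| <= e -> `|a * b| <= c * e.
  by move=> ac be; rewrite normrM ler_pM.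
have x2 := bound _ _ _ _ xr xr; have y2 := bound _ _ _ _ yr yr.
have xy2 := bound _ _ _ _ xr y2; have xxyy := bound _ _ _ _ x2 y2; have x2y := bound _ _ _ _ x2 yr.
have E0 : `|1 + x + x ^+ 2 / 2| <= 5 / 2.
  rewrite expr2; move: xr x2; rewrite !ler_norml => /andP[? ?] /andP[? ?].
  apply/andP; split; nra.
have b1 := bound _ _ _ _ pP (cos_max y); have b2 := bound _ _ _ _ E0 qP.
have b3 := bound _ _ _ _ pP (sin_max y); have b4 := bound _ _ _ _ E0 sP.
have r4 : r * r * (r * r) <= r ^+ 3.
  by rewrite !exprS expr0 mulr1 [leRHS]mulrA ler_wpM2l ?mulr_ge0// ler_piMl.
have half : 2^-1 = (2^-1)%:C :> R[i] by rewrite fmorphV rmorph_nat.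
apply: le_trans (normc_le_ReIm _) _.
set A := Re _; set B := Im _.
(* The terms of degree at most 2 cancel. What remains are monomials of degree 3 and 4 in x and y and
   products with one of the remainders [p], [q], [s], all of order r^3. *)
have -> : A = - (x * (y * y)) / 2 - x * x * (y * y) / 4 + p * cos y + (1 + x + x ^+ 2 / 2) * q.
  by rewrite /A expr2 half /cexp /= eexp ecos; field.
have -> : B = x * x * y / 2 + p * sin y + (1 + x + x ^+ 2 / 2) * s.
  by rewrite /B expr2 half /cexp /= eexp esin; field.
have c0 : 0 <= r ^+ 3 by rewrite exprn_ge0.
have r3E : r * r * r = r ^+ 3 by rewrite !exprS expr0; ring.
rewrite r3E in x2y; rewrite (mulrA r) r3E in xy2.
have {}xxyy := le_trans xxyy r4.
move: xy2 xxyy x2y b1 b2 b3 b4 c0; move: (r ^+ 3) => c.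
rewrite !ler_norml => /andP[? ?] /andP[? ?] /andP[? ?].
move=> /andP[? ?] /andP[? ?] /andP[? ?] /andP[? ?] c0.
apply: (@le_trans _ _ (8 * c + 8 * c)); last by lra.
by apply: lerD; rewrite ler_norml; apply/andP; split; lra.
Qed.

(* The principal branch of log (1 + u), correct only where 1 + Re u > 0. *)
Definition clog1p u : R[i] := ln (normc (1 + u)) +i* atan (Im u / (1 + Re u)).

Lemma normc_1p_bounds u : normc u <= 2^-1 ->
  [/\ 2^-1 <= 1 + Re u, 2^-1 <= normc (1 + u) & `|normc (1 + u) - 1| <= normc u].
Proof.
move=> u2; have := normr_Re_le u; have := normr_Re_le (1 + u).
have := le_normcD 1 u; have := le_normcD (1 + u) (- u); rewrite addrK normcN normc1 ReD /= => h1 h2.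
rewrite !ler_norml => /andP[a b] /andP[c d]; split; [|lra|].
  by rewrite -/(GRing.one R); lra.
by apply/andP; split; lra.
Qed.

Lemma cexp_clog1p u : normc u <= 2^-1 -> cexp (clog1p u) = 1 + u.
Proof.
move=> u2; have [x0 n0 _] := normc_1p_bounds u2.
have {}x0 : 0 < 1 + Re u by apply: lt_le_trans x0; rewrite invr_gt0.
have {}n0 : 0 < normc (1 + u) by apply: lt_le_trans n0; rewrite invr_gt0.
set t := Im u / (1 + Re u).
have ct : cos (atan t) = (1 + Re u) / normc (1 + u).
  rewrite cos_atan (_ : 1 + t ^+ 2 = (normc (1 + u) / (1 + Re u)) ^+ 2).
    by rewrite sqrtr_sqr gtr0_norm ?divr_gt0// invfM invrK mulrC.
  rewrite /t; case: (u) x0 => a b /= x0.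
  rewrite !exprMn sqr_sqrtr ?addr_ge0 ?sqr_ge0// -[X in _ = (X + _) * _]mul1r. 
  by field; rewrite gt_eqF.
have st : sin (atan t) = t * cos (atan t).
  have c0 : cos (atan t) != 0 by rewrite ct gt_eqF// divr_gt0.
  by rewrite -[X in X * _]atanK /tan divfK.
rewrite /cexp /clog1p -/t lnK ?posrE// st ct /t.
apply/eqP; rewrite eq_complex ReD ImD /=; apply/andP; split; apply/eqP; field.
all: by rewrite ?gt_eqF//.
Qed.

(** The real part uses log n <= n - 1 at both n = |1 + u| and 1/n, the imaginary part |atan t| <=
    |t|. Each contributes at most 2 |u|, as n and 1 + Re u are at least 1/2. *)
Lemma normc_clog1p u : normc u <= 2^-1 -> normc (clog1p u) <= 4 * normc u.
Proof.
move=> u2; have [x0 n0] := normc_1p_bounds u2; rewrite ler_norml => /andP[a b].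
have h0 : 0 < 2^-1 :> R by rewrite invr_gt0.
set n := normc (1 + u) in n0 a b *.
have n0' : 0 < n by lra.
apply: le_trans (normc_le_ReIm _) _; rewrite /clog1p -/n.
apply: (@le_trans _ _ (2 * normc u + 2 * normc u)); last by lra.
apply: lerD => /=.
  rewrite ler_norml; apply/andP; split; last first.
    by have := @le_ln1Dx R (n - 1); rewrite addrCA subrr addr0; lra.
  have := @le_ln1Dx R (n^-1 - 1); rewrite addrCA subrr addr0 lnV ?posrE// => h.
  have ni : n^-1 <= 2 by rewrite -[leRHS]invrK lef_pV2 ?posrE// invr_gt0.
  have ni0 : 0 < n^-1 by rewrite invr_gt0.
  have nn : n * n^-1 = 1 by rewrite divff// gt_eqF.
  have {}h : - ln n <= n^-1 - 1 by apply: h; lra.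
  have : n^-1 - 1 = n^-1 * (1 - n) by rewrite mulrBr mulr1 mulVf ?gt_eqF.
  have := normc_ge0 u; nra.
apply: le_trans (normr_atan_le _) _; rewrite normrM mulrC ler_pM//.
  rewrite normrV ?unitfE ?gt_eqF ?(lt_le_trans h0 x0)//.
  rewrite gtr0_norm ?(lt_le_trans h0 x0)// -[leRHS]invrK lef_pV2 ?posrE//.
  exact: lt_le_trans x0.
exact: normr_Im_le.
Qed.

Lemma clog1p0 : clog1p (0 : R[i]) = 0.
Proof.
apply/eqP; rewrite -normc_eq0 eq_le normc_ge0 andbT.
by have := @normc_clog1p 0; rewrite normc0 mulr0; apply; rewrite invr_ge0.
Qed.

(** Inverts the expansion of the exponential: d = [clog1p u] satisfies u = d + d^2/2 + O(d^3), and
    substituting this into u - u^2/2 leaves d up to O(d^3). The factor 4 comes from |d| <= 4 |u|. *)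
Lemma clog1p_taylor2 u : normc u <= 4^-1 ->
  normc (clog1p u - (u - u ^+ 2 / 2)) <= 200 * (4 * normc u) ^+ 3.
Proof.
move=> u4; have u2 : normc u <= 2^-1 by lra.
have dC := normc_clog1p u2; have E := cexp_clog1p u2.
set d := clog1p u in dC E *.
have d1 : normc d <= 1 by lra.
have := cexp_taylor2 d1; rewrite E.
set rho := _ - _ - _ - _ => rhoP.
have uE : u = d + d ^+ 2 / 2 + rho by rewrite /rho; ring.
set e := d ^+ 2 / 2 + rho.
have eP : normc e <= 17 * normc d ^+ 2.
  apply: le_trans (le_normcD _ _) _.
  rewrite normcM normcX normcV normc2.
  have := normc_ge0 d; move: rhoP d1; rewrite !exprS expr0; nra.
have -> : d - (u - u ^+ 2 / 2) = d * e + e ^+ 2 / 2 - rho.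
  by rewrite [u in LHS]uE /e; field.
have D0 := normc_ge0 d; have U0 := normc_ge0 u.
have n2 : normc (2^-1 : R[i]) = 2^-1 by rewrite normcV normc2.
have e0 := normc_ge0 e.
apply: (@le_trans _ _ (200 * normc d ^+ 3)); last first.
  by rewrite ler_wpM2l// lerXn2r// nnegrE ?mulr_ge0.
apply: le_trans (le_normcD _ _) _; rewrite normcN.
apply: (@le_trans _ _ (184 * normc d ^+ 3 + 16 * normc d ^+ 3)); last by lra.
apply: lerD => //; apply: le_trans (le_normcD _ _) _.
rewrite (normcM d) (normcM (e ^+ 2)) normcX n2.
have d4 : normc d ^+ 2 * normc d ^+ 2 <= normc d ^+ 3.
  rewrite (_ : _ * _ = normc d * normc d ^+ 3); last by ring.
  by rewrite ler_piMl ?exprn_ge0.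
have ee : normc e ^+ 2 <= 289 * (normc d ^+ 2 * normc d ^+ 2).
  rewrite expr2; apply: le_trans (ler_pM e0 e0 eP eP) _; lra.
have de : normc d * normc e <= 17 * normc d ^+ 3.
  by rewrite [_ ^+ 3]exprS mulrCA ler_wpM2l.
have := exprn_ge0 3 D0; lra.
Qed.

End ComplexExp.

(** * Complex 2-jets at 0 *)

Section Jets.
Context {R : realType}.
Implicit Types (s : R[i]) (f g : R[i] -> R[i]).

Definition near0 (P : R[i] -> Prop) :=
  exists2 d : R, 0 < d & forall s, normc s <= d -> P s.

Lemma near0_and P Q : near0 P -> near0 Q -> near0 (fun s => P s /\ Q s).
Proof.
move=> [d d0 dP] [e e0 eQ]; exists (Num.min d e); first by rewrite lt_min d0.
by move=> s; rewrite le_min => /andP[/dP ? /eQ].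
Qed.

Lemma near0_mono P Q : near0 P -> (forall s, P s -> Q s) -> near0 Q.
Proof. by move=> [d d0 dP] PQ; exists d => // s /dP/PQ. Qed.

Lemma near0_all (T : eqType) (L : seq T) (P : T -> R[i] -> Prop) :
  (forall t, t \in L -> near0 (P t)) ->
  near0 (fun s => forall t, t \in L -> P t s).
Proof.
elim: L => [|t L IH] LP; first by exists 1.
have := near0_and (LP t (mem_head _ _)) (IH (fun u uL => LP u (@mem_behead _ (t :: L) u uL))).
move=> h; apply: near0_mono h _ => s [Pt PL] u.
by rewrite inE => /orP[/eqP->|/PL].
Qed.

Definition lbounded f := exists C : R, near0 (fun s => normc (f s) <= C).

Lemma lbounded_cst c : lbounded (cst c).
Proof. by exists (normc c), 1. Qed.

Lemma lbounded_id : lbounded id.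
Proof. by exists 1, 1. Qed.

Lemma lboundedD f g : lbounded f -> lbounded g -> lbounded (fun s => f s + g s).
Proof.
move=> [C fC] [D gD]; exists (C + D).
apply: near0_mono (near0_and fC gD) _ => s [fs gs].
by apply: le_trans (le_normcD _ _) _; exact: lerD.
Qed.

Lemma lboundedM f g : lbounded f -> lbounded g -> lbounded (fun s => f s * g s).
Proof.
move=> [C fC] [D gD]; exists (C * D).
apply: near0_mono (near0_and fC gD) _ => s [fs gs].
by rewrite normcM ler_pM ?normc_ge0.
Qed.

(** A substitute for holomorphy near 0. The expansion is demanded for every s, but [r] is controlled
    only near 0, so only the germ of [f] is constrained. *)
Definition jet2 f := exists a b r, lbounded r /\
  forall s, f s = f 0 + a * s + b * s ^+ 2 + s ^+ 3 * r s.

Lemma jet2_lbounded f : jet2 f -> lbounded f.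
Proof.
move=> [a [b [r [rb fE]]]].
have : lbounded (fun s => cst (f 0) s + cst a s * id s
    + cst b s * (id s * id s) + id s * (id s * id s) * r s).
  by do ![apply: lboundedD|apply: lboundedM|exact: lbounded_cst|exact: lbounded_id|done].
move=> [C fC]; exists C; apply: near0_mono fC _ => s /=.
by rewrite [f s]fE !exprS expr0 !mulr1.
Qed.

Lemma jet2_cst c : jet2 (cst c).
Proof.
exists 0, 0, (cst 0); split=> [|s]; first exact: lbounded_cst.
by rewrite /cst !(mul0r, mulr0, addr0).
Qed.

Lemma jet2_id : jet2 id.
Proof.
exists 1, 0, (cst 0); split=> [|s]; first exact: lbounded_cst.
by rewrite /cst mul1r !(mul0r, mulr0, addr0, add0r).
Qed.

Lemma jet2D f g : jet2 f -> jet2 g -> jet2 (fun s => f s + g s).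
Proof.
move=> [a [b [r [rb fE]]]] [c [d [q [qb gE]]]].
exists (a + c), (b + d), (fun s => r s + q s); split=> [|s]; first exact: lboundedD.
by rewrite [f s]fE [g s]gE; ring.
Qed.

Lemma jet2M f g : jet2 f -> jet2 g -> jet2 (fun s => f s * g s).
Proof.
move=> fj gj; have gl := jet2_lbounded gj.
move: fj gj => [a [b [r [rb fE]]]] [c [d [q [qb gE]]]].
exists (a * g 0 + c * f 0), (b * g 0 + a * c + f 0 * d), (fun s =>
  cst (a * d + b * c) s + cst (b * d) s * id s + r s * g s +
  (cst (f 0) s + cst a s * id s + cst b s * (id s * id s)) * q s).
split=> [|s].
  by do ![apply: lboundedD|apply: lboundedM|exact: lbounded_cst|exact: lbounded_id|done].
by rewrite [f s]fE /cst /= [g s]gE; ring.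
Qed.

Lemma jet2_perturb f g : jet2 f -> lbounded g ->
  jet2 (fun s => f s + s ^+ 3 * g s).
Proof.
move=> [a [b [r [rb fE]]]] gb.
exists a, b, (fun s => r s + g s); split=> [|s]; first exact: lboundedD.
by rewrite [f s]fE; ring.
Qed.

Lemma jet2_cvg f (e : R) : jet2 f -> 0 < e -> near0 (fun s => normc (f s - f 0) <= e).
Proof.
move=> [a [b [r [rb fE]]]] e0.
have : lbounded (fun s => cst a s + cst b s * id s + id s * id s * r s).
  by do ![apply: lboundedD|apply: lboundedM|exact: lbounded_cst|exact: lbounded_id|done].
move=> [C [d d0 dC]]; have C0 : 0 <= C.
  by apply: le_trans (normc_ge0 _) (dC 0 _); rewrite ?normc0 ltW.
exists (Num.min d (e / (1 + C))); first by rewrite lt_min d0 divr_gt0// ltr_pwDl.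
move=> s; rewrite le_min => /andP[/dC sC se].
rewrite [f s]fE (_ : _ - _ = s * (a + b * s + s * s * r s)); last by ring.
rewrite normcM; apply: (@le_trans _ _ (e / (1 + C) * C)).
  by rewrite ler_pM ?normc_ge0.
rewrite mulrAC ler_pdivrMr ?ltr_pwDl// ler_wpM2l ?ltW//; lra.
Qed.

Lemma jet2_clog1p f : jet2 f -> f 0 = 0 -> jet2 (fun s => clog1p (f s)).
Proof.
move=> fj f0; have small : near0 (fun s => normc (f s) <= 4^-1).
  have h : near0 (fun s => normc (f s - f 0) <= 4^-1) by apply: jet2_cvg.
  by apply: near0_mono h _ => s; rewrite f0 subr0.
have [a [b [r [rb fE]]]] := fj.
pose m s := cst a s + cst b s * id s + id s * id s * r s.
have mb : lbounded m.
  by do ![apply: lboundedD|apply: lboundedM|exact: lbounded_cst|exact: lbounded_id|done].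
have fm s : f s = s * m s by rewrite [f s]fE f0 /m /cst /=; ring.
(* The remainder of the logarithm divided by f^3. The value 0 where f vanishes is right since
   [clog1p 0 = 0], and f = s m turns f^3 t into s^3 times a locally bounded function. *)
pose t s := if f s == 0 then 0 else (clog1p (f s) - (f s - f s ^+ 2 / 2)) / f s ^+ 3.
have tb : lbounded t.
  exists (200 * 4 ^+ 3); apply: near0_mono small _ => s fs; rewrite /t.
  have [_|nz] := eqVneq (f s) 0; first by rewrite normc0 mulr_ge0 ?exprn_ge0.
  rewrite normcM normcV normcX ler_pdivrMr ?exprn_gt0 ?normc_gt0//.
  by rewrite -(mulrA 200) -exprMn; exact: clog1p_taylor2.
have -> : (fun s => clog1p (f s)) =
    (fun s => (f s + f s * (cst (- 2^-1) s * f s)) + s ^+ 3 * (m s * (m s * m s) * t s)).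
  apply/funext => s; have -> : s ^+ 3 * (m s * (m s * m s) * t s) = f s ^+ 3 * t s.
    by rewrite fm; ring.
  rewrite /t /cst /=; have [->|nz] := eqVneq (f s) 0.
    by rewrite clog1p0; ring.
  by rewrite [X in _ = _ + X]mulrC divfK ?expf_neq0//; ring.
apply: jet2_perturb; last by do !apply: lboundedM.
by apply: jet2D => //; apply: jet2M => //; apply: jet2M => //; exact: jet2_cst.
Qed.

End Jets.

(** * Strict subharmonicity of Re f + e |z|^2 *)

Section MeanValue.
Context {R : realType}.

Lemma normc_sqr (z : R[i]) : normc z ^+ 2 = Re z ^+ 2 + Im z ^+ 2.
Proof. by case: z => a b /=; rewrite sqr_sqrtr ?addr_ge0 ?sqr_ge0. Qed.

(* Averaging over the four points s, -s, is, -is kills the terms of degree 1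
   and 2 of the jet, while it increases |z + s|^2 by |s|^2. *)
Lemma jet2_not_local_max (f : R[i] -> R[i]) (z : R[i]) (e : R) :
  jet2 f -> 0 < e ->
  ~ near0 (fun s => Re (f s) + e * normc (z + s) ^+ 2 <= Re (f 0) + e * normc z ^+ 2).
Proof.
move=> [a [b [r [[C rC] fE]]]] e0 fmax.
have [d d0 dP] := near0_and rC fmax.
have C0 : 0 <= C by apply: le_trans (normc_ge0 _) (proj1 (dP 0 _)); rewrite ?normc0 ltW.
(* Over the four points at distance t the quadratic term gains 4 e t^2, while the cubic remainders
   cost at most 4 C t^3; hence the choice t C < e. *)
pose t := Num.min d (e / (1 + C)).
have t0 : 0 < t by rewrite lt_min d0 divr_gt0// ltr_pwDl.
have td : t <= d by rewrite ge_min lexx.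
have tC : t * C < e.
  apply: (@le_lt_trans _ _ (e / (1 + C) * C)).
    by rewrite ler_wpM2r// ge_min lexx orbT.
  by rewrite mulrAC ltr_pdivrMr ?ltr_pwDl// ltr_pM2l//; lra.
have tt : `|t| = t by rewrite gtr0_norm.
pose s1 : R[i] := t%:C; pose s2 : R[i] := 'i%C * t%:C.
have n1 : normc s1 = t by rewrite normc_real.
have n2 : normc s2 = t.
  by rewrite normcM normc_real tt /= expr0n expr1n add0r sqrtr1 mul1r.
have s12 : s2 ^+ 2 = - s1 ^+ 2 by rewrite exprMn sqr_i mulN1r.
have s0 (s : R[i]) : normc s = t -> normc s <= d by move=> ->.
have [r1 m1] := dP s1 (s0 _ n1); have [r2 m2] := dP s2 (s0 _ n2).
have [r3 m3] := dP (- s1) (s0 _ (etrans (normcN _) n1)).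
have [r4 m4] := dP (- s2) (s0 _ (etrans (normcN _) n2)).
have sum : f s1 + f s2 + f (- s1) + f (- s2) - f 0 - f 0 - f 0 - f 0 =
    s1 ^+ 3 * (r s1 - r (- s1)) + s2 ^+ 3 * (r s2 - r (- s2)).
  have h : b * s1 ^+ 2 + b * s2 ^+ 2 = 0 by rewrite s12; ring.
  rewrite (fE s1) (fE s2) (fE (- s1)) (fE (- s2)).
  rewrite -[RHS]addr0 -(mulr0 2) -h; ring.
have := congr1 (@complex.Re R) sum; rewrite !ReD !ReN => {}sum.
have bnd (s p q : R[i]) : normc s = t -> normc p <= C -> normc q <= C ->
    - (2 * C * t ^+ 3) <= Re (s ^+ 3 * (p - q)).
  move=> st pC qC; have := normr_Re_le (s ^+ 3 * (p - q)).
  rewrite ler_norml => /andP[+ _]; apply: le_trans; rewrite lerN2.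
  rewrite normcM normcX st mulrC ler_wpM2r ?exprn_ge0 ?(ltW t0)//.
  by apply: le_trans (le_normcD _ _) _; rewrite normcN mulr2n mulrDl !mul1r lerD.
have b1 := bnd _ _ _ n1 r1 r3; have b2 := bnd _ _ _ n2 r2 r4.
have t2 : t ^+ 3 * C < e * t ^+ 2.
  by rewrite exprSr -mulrA mulrC ltr_pM2r ?exprn_gt0.
move: m1 m2 m3 m4; rewrite !normc_sqr !ReD !ImD !ReN !ImN /s1 /s2 /=.
rewrite !(mulr0, mul0r, mul1r, addr0, add0r, subr0, oppr0, sub0r).
nra.
Qed.

End MeanValue.

(** * The tower of logarithms *)

(** Polynomials in z and the w_a with Gaussian rational coefficients. As [Tlog a] is the coordinate
    w_a for an arbitrary term a, one countable inductive type holds all stages of the tower. *)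
Inductive term :=
  | Tvar
  | Tcst of rat & rat
  | Tadd of term & term
  | Tmul of term & term
  | Tlog of term.

Fixpoint term_encode (t : term) : GenTree.tree (rat * rat) :=
  match t with
  | Tvar => GenTree.Node 0 [::]
  | Tcst p q => GenTree.Leaf (p, q)
  | Tadd a b => GenTree.Node 1 [:: term_encode a; term_encode b]
  | Tmul a b => GenTree.Node 2 [:: term_encode a; term_encode b]
  | Tlog a => GenTree.Node 3 [:: term_encode a]
  end.

Fixpoint term_decode (t : GenTree.tree (rat * rat)) : option term :=
  match t with
  | GenTree.Node 0 [::] => Some Tvar
  | GenTree.Leaf (p, q) => Some (Tcst p q)
  | GenTree.Node 1 [:: a; b] =>
      if (term_decode a, term_decode b) is (Some a', Some b')
      then Some (Tadd a' b') else None
  | GenTree.Node 2 [:: a; b] =>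
      if (term_decode a, term_decode b) is (Some a', Some b')
      then Some (Tmul a' b') else None
  | GenTree.Node 3 [:: a] => omap Tlog (term_decode a)
  | _ => None
  end.

Lemma term_encodeK : pcancel term_encode term_decode.
Proof. by elim=> //= [a -> b ->|a -> b ->|a ->]. Qed.

HB.instance Definition _ := Countable.copy term (pcan_type term_encodeK).

Section Tower.
Context {R : realType}.
Implicit Types (c : option term -> R[i]) (t a : term) (L : seq term).

(* c None is the coordinate z and c (Some a) the coordinate w_a. *)
Fixpoint teval c t : R[i] :=
  match t with
  | Tvar => c None
  | Tcst p q => ratr p +i* ratr q
  | Tadd a b => teval c a + teval c b
  | Tmul a b => teval c a * teval c b
  | Tlog a => c (Some a)
  end.

(* The germ at c of the branch of the tower over c None + s: the coordinates
   Some a with a in L follow a local branch of the logarithm of a, and the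
   others are frozen. *)
Fixpoint lift_val L c (s : R[i]) t : R[i] :=
  match t with
  | Tvar => c None + s
  | Tcst p q => ratr p +i* ratr q
  | Tadd a b => lift_val L c s a + lift_val L c s b
  | Tmul a b => lift_val L c s a * lift_val L c s b
  | Tlog a => c (Some a) +
      if a \in L then clog1p (lift_val L c s a / teval c a - 1) else 0
  end.

Definition lift_conf L c (s : R[i]) (o : option term) : R[i] :=
  if o is Some a then lift_val L c s (Tlog a) else c None + s.

Lemma teval_lift L c s t : teval (lift_conf L c s) t = lift_val L c s t.
Proof. by elim: t => //= [a -> b ->|a -> b ->]. Qed.

Section Lift.
Context (L : seq term) (c : option term -> R[i])
  (c_neq0 : forall a, a \in L -> teval c a != 0).

Lemma lift_val0 t : lift_val L c 0 t = teval c t.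
Proof.
elim: t => //= [|a -> b ->|a -> b ->|a IH] //; first by rewrite addr0.
by case: ifPn => [/c_neq0 ca|_]; rewrite ?addr0// IH divff// subrr clog1p0 addr0.
Qed.

Lemma jet2_lift_val t : jet2 (fun s => lift_val L c s t).
Proof.
elim: t => /= [|p q|a IHa b IHb|a IHa b IHb|a IH].
- by apply: jet2D; [exact: jet2_cst|exact: jet2_id].
- exact: jet2_cst.
- exact: jet2D.
- exact: jet2M.
- apply: jet2D; first exact: jet2_cst.
  have [/c_neq0 ca|_] := boolP (a \in L); last exact: jet2_cst.
  apply: jet2_clog1p; last by rewrite lift_val0 divff// subrr.
  by apply: jet2D; [apply: jet2M|]; try exact: jet2_cst.
Qed.

Lemma lift_val_cvg t (e : R) : 0 < e ->
  near0 (fun s => normc (lift_val L c s t - teval c t) <= e).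
Proof.
by move=> e0; have := jet2_cvg (jet2_lift_val t) e0; rewrite lift_val0.
Qed.

(** For small s the value of a along the lift, divided by its initial value, is within 1/2 of 1,
    where [clog1p] is a true logarithm. So exp w_a changes by the same factor as a. *)
Lemma cexp_lift a : a \in L -> near0 (fun s =>
  cexp (lift_val L c s (Tlog a)) = cexp (c (Some a)) * (lift_val L c s a / teval c a)).
Proof.
move=> aL; have ca := c_neq0 aL.
have h : near0 (fun s => normc (lift_val L c s a - teval c a) <= normc (teval c a) / 2).
  by apply: lift_val_cvg; rewrite divr_gt0 ?normc_gt0.
apply: near0_mono h _ => s hs /=.
rewrite aL cexpD cexp_clog1p ?(addrC 1) ?subrK//.
rewrite (_ : _ / _ - 1 = (lift_val L c s a - teval c a) / teval c a); last first.
  by rewrite mulrBl divff.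
by rewrite normcM normcV ler_pdivrMr ?normc_gt0// mulrC.
Qed.

End Lift.

Lemma jet2_sum (I : Type) (r : seq I) (f : I -> R[i] -> R[i]) :
  (forall i, jet2 (f i)) -> jet2 (fun s => \sum_(i <- r) f i s).
Proof.
move=> fj; elim: r => [|i r IH].
  by under eq_fun do rewrite big_nil; exact: jet2_cst.
by under eq_fun do rewrite big_cons; exact: jet2D.
Qed.

(** Along the lift, 2 - w_a is its initial value times [1 + v a s] with [v a 0 = 0], so log |2 -
    w_a| changes by the real part of [clog1p (v a s)]. Up to a constant the functional is thus the
    real part of a jet plus e |z + s|^2, which has no local maximum. *)
Lemma lift_not_local_max L c (w : term -> R) t (e : R) :
  (forall a, a \in L -> teval c a != 0) ->
  (forall a, a \in L -> c (Some a) != 2) -> 0 < e ->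
  let u c := Re (1 - c None * teval c t)
    - \sum_(a <- L) w a * ln (normc (2 - c (Some a))) + e * normc (c None) ^+ 2 in
  ~ near0 (fun s => u (lift_conf L c s) <= u c).
Proof.
move=> c0 c2 e0 u umax.
pose v a s := (c (Some a) - lift_val L c s (Tlog a)) / (2 - c (Some a)).
have v0 a : v a 0 = 0 by rewrite /v lift_val0// subrr mul0r.
have vj a : jet2 (v a).
  apply: jet2M; last exact: jet2_cst.
  rewrite (_ : (fun s => _) = (fun s => c (Some a) + cst (-1) s * lift_val L c s (Tlog a))).
    apply: jet2D; first exact: jet2_cst.
    by apply: jet2M; [exact: jet2_cst|exact: jet2_lift_val].
  by apply/funext => s; rewrite mulN1r.
pose f s := 1 + cst (-1) s * (lift_val L c s Tvar * lift_val L c s t)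
  + \sum_(a <- L) cst (- (w a)%:C) s * clog1p (v a s).
have fj : jet2 f.
  apply: jet2D; last first.
    by apply: jet2_sum => a; apply: jet2M; [exact: jet2_cst|exact: jet2_clog1p].
  apply: jet2D; first exact: jet2_cst.
  by apply: jet2M; [exact: jet2_cst|apply: jet2M; exact: jet2_lift_val].
apply: (jet2_not_local_max (z := c None) fj e0).
have vs : near0 (fun s => forall a, a \in L -> normc (v a s) <= 2^-1).
  apply: near0_all => a _.
  have h : near0 (fun s => normc (v a s - v a 0) <= 2^-1).
    by apply: jet2_cvg; rewrite ?invr_gt0.
  by apply: near0_mono h _ => s; rewrite v0 subr0.
have ReS (g : term -> R[i]) : Re (\sum_(a <- L) g a) = \sum_(a <- L) Re (g a).
  by elim: (L) => [|a l IH]; rewrite ?big_nil// !big_cons ReD IH.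
pose k := \sum_(a <- L) w a * ln (normc (2 - c (Some a))).
have uE s : (forall a, a \in L -> normc (v a s) <= 2^-1) ->
    u (lift_conf L c s) = Re (f s) + e * normc (c None + s) ^+ 2 - k.
  move=> sv; rewrite /u /f /k teval_lift !ReD !ReN.
  rewrite ReS (_ : \sum_(a <- L) Re _ = - \sum_(a <- L) w a * Re (clog1p (v a s))); last first.
    rewrite -sumrN; apply: eq_big_seq => a aL.
    by rewrite /cst; case: (clog1p _) => x y /=; ring.
  rewrite (_ : \sum_(a <- L) w a * ln _ = \sum_(a <- L) w a * ln (normc (2 - c (Some a)))
     + \sum_(a <- L) w a * Re (clog1p (v a s))); last first.
    rewrite -big_split; apply: eq_big_seq => a aL /=; rewrite -mulrDr -lnM ?posrE.
    - rewrite -normcM mulrDr mulr1 /v mulrCA divff ?mulr1; last first.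
        by rewrite subr_eq0 eq_sym c2.
      by congr (_ * ln (normc _)); rewrite /=; ring.
    - by rewrite normc_gt0 subr_eq0 eq_sym c2.
    - have [_ n0 _] := normc_1p_bounds (sv a aL).
      by apply: lt_le_trans n0; rewrite invr_gt0.
  by rewrite /cst mulN1r ReN /=; ring.
have uE0 : u c = Re (f 0) + e * normc (c None) ^+ 2 - k.
  have <- : u (lift_conf L c 0) = u c.
    have E : lift_conf L c 0 = c.
      by apply/funext => -[a|]; [exact: (lift_val0 c0 (Tlog a))|exact: addr0].
    by rewrite E.
  by rewrite uE ?addr0// => a aL; rewrite v0 normc0 invr_ge0.
apply: near0_mono (near0_and vs umax) _ => s [sv].
by rewrite uE// uE0 lerD2r.
Qed.

End Tower.

(** * Summable weights on the terms *)

Section Weights.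
Context {R : realType}.

Lemma sum_half_pow n : \sum_(0 <= k < n) (2^-1 : R) ^+ k.+1 = 1 - 2^-1 ^+ n.
Proof.
elim: n => [|n IH]; first by rewrite big_geq// expr0 subrr.
by rewrite big_nat_recr//= IH exprS; field.
Qed.

(** The total 1/4 is what the logarithms may cost at the base point, where 1 - z p equals 1. *)
Definition weight (a : term) : R := 4^-1 * 2^-1 ^+ (pickle a).+1.

Lemma weight_gt0 a : 0 < weight a.
Proof. by rewrite mulr_gt0 ?exprn_gt0 ?invr_gt0. Qed.

(** Distinct terms have distinct codes, so the sum is part of a geometric series. *)
Lemma sum_weight_le (L : seq term) : uniq L -> \sum_(a <- L) weight a <= 4^-1.
Proof.
move=> uL; rewrite -mulr_sumr ler_piMr ?invr_ge0//.
pose s := map pickle L; have us : uniq s by rewrite map_inj_uniq//; exact: (pcan_inj pickleK).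
rewrite -(big_map pickle xpredT (fun k => 2^-1 ^+ k.+1)) -/s.
pose n := (\max_(k <- s) k).+1.
have sn k : k \in s -> (k < n)%N by move=> ks; rewrite ltnS; apply: leq_bigmax_seq.
have -> : \sum_(k <- s) (2^-1 : R) ^+ k.+1 = \sum_(k <- [seq k <- iota 0 n | k \in s]) 2^-1 ^+ k.+1.
  apply: perm_big; apply: uniq_perm => //; first by rewrite filter_uniq// iota_uniq.
  by move=> k; rewrite mem_filter mem_iota add0n/=; case: (boolP (k \in s)) => // /sn ->.
rewrite big_filter; apply: (@le_trans _ _ (\sum_(0 <= k < n) (2^-1 : R) ^+ k.+1)).
  rewrite big_mkcond; rewrite /index_iota subn0; apply: ler_sum => k _.
  by case: ifP => // _; rewrite exprn_ge0 ?invr_ge0.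
by rewrite sum_half_pow lerBlDr lerDl exprn_ge0 ?invr_ge0.
Qed.

End Weights.

(** * The base point, the radii and the relations of the tower *)

Section Base.
Context {R : realType}.
Implicit Types (c : option term -> R[i]) (a t : term).

(** An arbitrary choice of logarithm, used only to fix the base point. The default 0 occurs just for
    z = 0 and keeps Re w_a <= 0 there. *)
Definition clog (z : R[i]) : R[i] := xget 0 [set v | cexp v = z].

Lemma cexp_clog z : z != 0 -> cexp (clog z) = z.
Proof.
move=> /cexp_surj [w wz]; rewrite /clog.
by case: xgetP => [v _ //|/(_ w) /(_ wz)].
Qed.

(* The summand 1 makes eps_a log |2 - w_a| at most weight a at the base point. *)
Definition eps_of (a : term) (v : R[i]) : R := weight a / (1 + ln (normc (2 - v))).

(* (base_bound t).1 is the value of t at the base point, (base_bound t).2 a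
   bound for |t| on the whole tower, which for t = Tlog a is the radius R_a. *)
Fixpoint base_bound t : R[i] * R :=
  match t with
  | Tvar => (0, 1)
  | Tcst p q => (ratr p +i* ratr q, normc (ratr p +i* ratr q : R[i]))
  | Tadd a b => ((base_bound a).1 + (base_bound b).1, (base_bound a).2 + (base_bound b).2)
  | Tmul a b => ((base_bound a).1 * (base_bound b).1, (base_bound a).2 * (base_bound b).2)
  | Tlog a => let v := clog ((base_bound a).1 / (1 + (base_bound a).2)%:C) in
      (v, 2 + expR (eps_of a v)^-1)
  end.

Definition bound t := (base_bound t).2.

Definition base (o : option term) : R[i] :=
  if o is Some a then (base_bound (Tlog a)).1 else 0.

Lemma teval_base t : teval base t = (base_bound t).1.
Proof. by elim: t => //= [a -> b ->|a -> b ->]. Qed.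

Definition eps a := eps_of a (base (Some a)).

Definition bounded c := forall o, normc (c o) <= (if o is Some a then bound (Tlog a) else 1).

Definition log_rel c a := cexp (c (Some a)) * (1 + bound a)%:C = teval c a.

(** [L] selects the relations imposed: a list at a finite level, everything in the limit.
    Coordinates without a relation range freely over their discs, so all levels are closed subsets
    of one compact set. An a that vanishes at the base point gets no relation, since it has no
    logarithm there. *)
Definition tower (L : term -> Prop) c :=
  bounded c /\ forall a, L a -> teval base a != 0 -> log_rel c a.

Lemma bounded_teval c t : bounded c -> normc (teval c t) <= bound t.
Proof.
move=> cb; elim: t => [|p q|a IHa b IHb|a IHa b IHb|a _].
- exact: (cb None).
- by [].
- by apply: le_trans (le_normcD _ _) _; exact: lerD.
- by rewrite /= normcM ler_pM ?normc_ge0.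
- exact: (cb (Some a)).
Qed.

Lemma bound_ge0 t : 0 <= bound t.
Proof.
rewrite /bound; elim: t => //= a IHa b IHb; [exact: addr_ge0|exact: mulr_ge0].
Qed.

Lemma scale_neq0 t : (1 + bound t)%:C != 0 :> R[i].
Proof. by rewrite -normc_gt0 normc_real normr_gt0 gt_eqF// ltr_pwDl ?bound_ge0. Qed.

(** [1 + bound a] is S_a and exceeds |a|, so |exp w_a| = |a| / S_a < 1. *)
Lemma log_rel_Re_le0 c a : normc (teval c a) <= bound a -> log_rel c a ->
  Re (c (Some a)) <= 0.
Proof.
move=> ca /(congr1 (@normc R)); rewrite normcM normc_cexp normc_real => E.
have b0 := bound_ge0 a; rewrite -expR_le1.
move: E ca; rewrite ger0_norm ?addr_ge0// => <-.
have := expR_gt0 (Re (c (Some a))); nra.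
Qed.

Lemma normc_2B_ge2 (z : R[i]) : Re z <= 0 -> 2 <= normc (2 - z).
Proof.
move=> z0; apply: le_trans (normr_Re_le _); apply: le_trans (ler_norm _).
by rewrite ReD ReN (_ : Re 2 = 2)//; lra.
Qed.

(** The first bound for a term a gives |exp w_a| < 1 at the base point, hence the second bound for
    a, and from this the first bound for [Tlog a]. *)
Lemma base_bounds t :
  normc (teval base t) <= bound t /\ Re (base (Some t)) <= 0.
Proof.
have step a : normc (teval base a) <= bound a -> Re (base (Some a)) <= 0.
  move=> ha; have [a0|a0] := eqVneq (teval base a) 0; last first.
    apply: log_rel_Re_le0 ha _; rewrite /log_rel /= -/(bound a) -teval_base.
    by rewrite cexp_clog ?divfK ?mulf_neq0 ?invr_eq0 ?scale_neq0.
  rewrite /= -teval_base a0 mul0r /clog; case: xgetP => //= v _ /(congr1 (@normc R)).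
  by rewrite normc_cexp normc0 => /eqP; rewrite expR_eq0.
suff ht : normc (teval base t) <= bound t by split=> //; exact: step.
elim: t => [|p q|a IHa b IHb|a IHa b IHb|a IH].
- by rewrite (_ : teval _ _ = 0) ?normc0.
- by [].
- by apply: le_trans (le_normcD _ _) _; exact: lerD.
- by rewrite /= normcM ler_pM ?normc_ge0.
have n2 := normc_2B_ge2 (step _ IH).
rewrite /bound [X in _ <= X]/= -/(bound a) -[teval _ _]/(base (Some a)) -/(base (Some a)) -/(eps a).
set v := base (Some a) in n2 *.
have l0 : 0 <= ln (normc (2 - v)) by rewrite ln_ge0//; lra.
(* 1/eps_a is (1 + log |2 - v|) / [weight a] with [weight a] <= 1, so it dominates the logarithm.
   Then |v| <= 2 + |2 - v| <= 2 + exp (1/eps_a) = R_a. *)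
have le1 : ln (normc (2 - v)) <= (eps a)^-1.
  rewrite /eps /eps_of -/v invfM invrK.
  have w1 : 1 <= (weight a)^-1 :> R.
    rewrite invf_ge1 ?weight_gt0// (le_trans (_ : _ <= 4^-1)) ?invf_le1//; last by lra.
    by have := @sum_weight_le R [:: a] isT; rewrite big_seq1.
  nra.
have n0 : 0 < normc (2 - v) by lra.
have : normc (2 - v) <= expR (eps a)^-1 by rewrite -[leLHS]lnK ?ler_expR.
have := le_normcD 2 (- (2 - v)); rewrite normcN opprB addrC subrK.
rewrite normc2; lra.
Qed.

Lemma base_tower : tower setT base.
Proof.
split=> [[a|]|a _ a0]; first exact: (base_bounds (Tlog a)).1.
  by rewrite [base _]/(0 : R[i]) normc0.
rewrite /log_rel /= -/(bound a) -teval_base.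
by rewrite cexp_clog ?divfK ?mulf_neq0 ?invr_eq0 ?scale_neq0.
Qed.

Lemma eps_gt0 a : 0 < eps a.
Proof.
rewrite divr_gt0 ?weight_gt0// ltr_pwDl// ln_ge0//.
by have := normc_2B_ge2 (base_bounds a).2; lra.
Qed.

Lemma eps_base_le a : eps a * ln (normc (2 - base (Some a))) <= weight a.
Proof.
have n2 := normc_2B_ge2 (base_bounds a).2.
have l0 : 0 <= ln (normc (2 - base (Some a))) by rewrite ln_ge0//; lra.
have w0 := @weight_gt0 R a.
rewrite /eps /eps_of mulrAC ler_pdivrMr ?ltr_pwDl// ler_wpM2l ?ltW//; lra.
Qed.

End Base.

(** * Topology of the tower *)

Section ComplexContinuity.
Context {R : realType} {T : topologicalType}.
Implicit Types f g : T -> R[i].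

Definition ccontinuous f :=
  continuous (fun x => Re (f x)) /\ continuous (fun x => Im (f x)).

Lemma ccontinuous_cst z : ccontinuous (fun=> z).
Proof. by split; exact: cst_continuous. Qed.

Lemma ccontinuousD f g : ccontinuous f -> ccontinuous g ->
  ccontinuous (fun x => f x + g x).
Proof.
move=> [f1 f2] [g1 g2]; split=> x.
  by under eq_fun do rewrite ReD; apply: cvgD; [exact: f1|exact: g1].
by under eq_fun do rewrite ImD; apply: cvgD; [exact: f2|exact: g2].
Qed.

Lemma ccontinuousN f : ccontinuous f -> ccontinuous (fun x => - f x).
Proof.
move=> [f1 f2]; split=> x.
  by under eq_fun do rewrite ReN; apply: cvgN; exact: f1.
by under eq_fun do rewrite ImN; apply: cvgN; exact: f2.
Qed.

Lemma ccontinuousM f g : ccontinuous f -> ccontinuous g ->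
  ccontinuous (fun x => f x * g x).
Proof.
move=> [f1 f2] [g1 g2]; split=> x.
  under eq_fun do rewrite ReM.
  by apply: cvgB; apply: cvgM; [exact: f1|exact: g1|exact: f2|exact: g2].
under eq_fun do rewrite ImM.
by apply: cvgD; apply: cvgM; [exact: f1|exact: g2|exact: f2|exact: g1].
Qed.

Lemma ccontinuous_conj f : ccontinuous f -> ccontinuous (fun x => (f x)^*).
Proof.
move=> [f1 f2].
have E1 : (fun x => Re (f x)^*) = (fun x => Re (f x)) by apply/funext => x; case: (f x).
have E2 : (fun x => Im (f x)^*) = (fun x => - Im (f x)) by apply/funext => x; case: (f x).
by rewrite /ccontinuous E1 E2; split=> // x; apply: cvgN; exact: f2.
Qed.

Lemma ccontinuous_cexp f : ccontinuous f -> ccontinuous (fun x => cexp (f x)).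
Proof.
have cE z : cexp z = (expR (Re z) * cos (Im z)) +i* (expR (Re z) * sin (Im z)) by case: z.
move=> [f1 f2]; split=> x; under eq_fun do rewrite cE /=.
  apply: cvgM; first exact: (continuous_comp (f1 x) (@continuous_expR R _)).
  exact: (continuous_comp (f2 x) (@continuous_cos R _)).
apply: cvgM; first exact: (continuous_comp (f1 x) (@continuous_expR R _)).
exact: (continuous_comp (f2 x) (@continuous_sin R _)).
Qed.

Lemma continuous_normc f : ccontinuous f -> continuous (fun x => normc (f x)).
Proof.
move=> [f1 f2] x.
have -> : (fun x => normc (f x)) = (fun x => Num.sqrt (Re (f x) ^+ 2 + Im (f x) ^+ 2)).
  by apply/funext => y; case: (f y).
apply: (@continuous_comp _ _ _ (fun y => Re (f y) ^+ 2 + Im (f y) ^+ 2) Num.sqrt).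
  by apply: cvgD; rewrite !expr2; apply: cvgM; [exact: f1|exact: f1|exact: f2|exact: f2].
exact: sqrt_continuous.
Qed.

Lemma closed_normc_le f (k : R) : ccontinuous f -> closed [set x | normc (f x) <= k].
Proof.
move=> /continuous_normc fc.
by apply: (@preimage_closed _ _ _ [set y | y <= k]) (@closed_le R k) => x _; exact: fc.
Qed.

Lemma closed_normc_ge f (k : R) : ccontinuous f -> closed [set x | k <= normc (f x)].
Proof.
move=> /continuous_normc fc.
by apply: (@preimage_closed _ _ _ [set y | k <= y]) (@closed_ge R k) => x _; exact: fc.
Qed.

Lemma closed_eqc f g : ccontinuous f -> ccontinuous g -> closed [set x | f x = g x].
Proof.
move=> fc /ccontinuousN gc; have h := closed_normc_le (k := 0) (ccontinuousD fc gc).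
rewrite (_ : [set x | _] = [set x | normc (f x - g x) <= 0])//.
apply/seteqP; split=> x /= => [->|]; first by rewrite subrr normc0.
move=> n0; apply/eqP; rewrite -subr_eq0 -normc_eq0 eq_le n0.
exact: normc_ge0.
Qed.

End ComplexContinuity.

(* Complex coordinates are stored as pairs of real ones. *)
Definition config (R : realType) : topologicalType :=
  prod_topology (fun _ : option term * bool => R).

Section TowerSpace.
Context {R : realType}.
Local Notation config := (config R).

Definition coord (x : config) (o : option term) : R[i] := x (o, false) +i* x (o, true).

Definition of_coord (c : option term -> R[i]) : config :=
  fun i => if i.2 then Im (c i.1) else Re (c i.1).

Lemma of_coordK c : coord (of_coord c) = c.
Proof. by apply/funext => o; rewrite /coord /of_coord /=; case: (c o). Qed.

Lemma ccontinuous_coord o : ccontinuous (coord ^~ o).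
Proof. by split; exact: (@proj_continuous _ (fun=> R)). Qed.

Lemma ccontinuous_teval t : ccontinuous (fun x => teval (coord x) t).
Proof.
elim: t => [|p q|a IHa b IHb|a IHa b IHb|a _] /=.
- exact: ccontinuous_coord.
- exact: ccontinuous_cst.
- exact: ccontinuousD.
- exact: ccontinuousM.
- exact: ccontinuous_coord.
Qed.

Lemma closed_log_rel a : closed [set x : config | teval base a != 0 :> R[i] -> log_rel (coord x) a].
Proof.
have [_|_] := eqVneq (teval base a) (0 : R[i]).
  rewrite (_ : [set _ | _] = [set: config]); first exact: closedT.
  by apply/seteqP; split.
rewrite (_ : [set _ | _] = [set x : config | log_rel (coord x) a]).
  apply: closed_eqc; last exact: ccontinuous_teval.
  apply: ccontinuousM; last exact: ccontinuous_cst.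
  by apply: ccontinuous_cexp; exact: ccontinuous_coord.
by apply/seteqP; split=> x //= /(_ isT).
Qed.

Lemma closed_bounded : closed [set x : config | bounded (coord x)].
Proof.
rewrite (_ : [set _ | _] = \bigcap_(o in setT)
    [set x : config | normc (coord x o) <= (if o is Some a then bound (Tlog a) else 1)]).
  by apply: closed_bigI => o _; apply: closed_normc_le; exact: ccontinuous_coord.
by apply/seteqP; split=> x /= h o; [move=> _; exact: h|exact: h].
Qed.

(** Closed in a product of segments, which is compact by Tychonoff. *)
Lemma compact_bounded : compact [set x : config | bounded (coord x)].
Proof.
pose rad o : R := if o is Some a then bound (Tlog a) else 1.
apply: (@subclosed_compact _ _ [set x : config | forall i, `[- rad i.1, rad i.1]%classic (x i)]).
- exact: closed_bounded.
- apply: (@tychonoff _ (fun=> R) (fun i => `[- rad i.1, rad i.1]%classic)) => i.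
  exact: segment_compact.
- move=> x /= xb; case=> o b; rewrite /= in_itv/= -ler_norml.
  apply: le_trans (xb o); case: b; first exact: (normr_Im_le (coord x o)).
  exact: (normr_Re_le (coord x o)).
Qed.

Lemma compact_tower L : compact [set x : config | tower L (coord x)].
Proof.
apply: (subclosed_compact _ compact_bounded) => [|x []//].
rewrite (_ : [set _ | _] = [set x : config | bounded (coord x)] `&`
    \bigcap_(a in L) [set x : config | teval base a != 0 :> R[i] -> log_rel (coord x) a]).
  by apply: closedI; [exact: closed_bounded|apply: closed_bigI => a _; exact: closed_log_rel].
by apply/seteqP; split=> x.
Qed.

End TowerSpace.

(** * Continuity of the functional u *)

Section LogFunctional.
Context {R : realType} {T : topologicalType} {I : eqType}.

(** Lets u attain its maximum on a compact level; the logarithms are continuous away from w_i =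
    2. *)
Lemma continuous_log_functional (x : T) (z f : T -> R[i]) (w : I -> T -> R[i])
    (e : I -> R) (k : R) (l : seq I) :
  ccontinuous z -> ccontinuous f -> (forall i, ccontinuous (w i)) ->
  (forall i, i \in l -> 0 < normc (2 - w i x)) ->
  {for x, continuous (fun y => Re (1 - z y * f y)
    - \sum_(i <- l) e i * ln (normc (2 - w i y)) + k * normc (z y) ^+ 2)}.
Proof.
move=> zc fc wc w0.
have h1 : Re (1 - z y * f y) @[y --> x] --> Re (1 - z x * f x).
  have [h _] := ccontinuousD (ccontinuous_cst 1) (ccontinuousN (ccontinuousM zc fc)).
  exact: h.
have h2 : \sum_(i <- l) e i * ln (normc (2 - w i y)) @[y --> x]
    --> \sum_(i <- l) e i * ln (normc (2 - w i x)).
  elim: l w0 => [|i l IH] w0.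
    by under eq_fun do rewrite big_nil; rewrite big_nil; exact: cvg_cst.
  under eq_fun do rewrite big_cons; rewrite big_cons; apply: cvgD; last first.
    by apply: IH => j jl; apply: w0; rewrite inE jl orbT.
  apply: cvgM; first exact: cvg_cst.
  have hn : normc (2 - w i y) @[y --> x] --> normc (2 - w i x).
    exact: continuous_normc (ccontinuousD (ccontinuous_cst 2) (ccontinuousN (wc i))) x.
  apply: cvg_comp hn _.
  by apply: continuous_ln; apply: w0; exact: mem_head.
have h3 : normc (z y) @[y --> x] --> normc (z x) by apply: continuous_normc.
exact: (cvgD (cvgB h1 h2) (cvgM (cvg_cst k) (cvgM h3 h3))).
Qed.

End LogFunctional.

(** * The gap to conj z at finite levels and in the limit *)

Section FiniteLevel.
Context {R : realType}.
Local Notation config := (config R).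

(** The sets [A] intersected with [g i] generate a proper filter, and a cluster point of it in [A]
    lies in every closed [g i]. The index [i0] puts [A] itself in the filter. *)
Lemma compact_finI (T : topologicalType) (I : choiceType) (i0 : I) (A : set T) (g : I -> set T) :
  compact A -> (forall i, closed (g i)) ->
  (forall s : seq I, uniq s -> exists2 x, A x & forall i, i \in s -> g i x) ->
  exists2 x, A x & forall i, g i x.
Proof.
move=> cA gcl fin.
have finIg : finI setT (fun i => A `&` g i).
  move=> D _; have [x Ax gx] := fin (finmap.enum_fset D) (finmap.fset_uniq D).
  by exists x => i /= iD; split=> //; exact: gx.
have [|p [Ap pcl]] := cA _ (finI_filter finIg).
  by exists (A `&` g i0); [exact: finI_from1|move=> ? []].
exists p => // i; apply: gcl => B nB; apply: pcl => //.
by exists (A `&` g i); [exact: finI_from1|move=> ? []].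
Qed.

(** Re w_a <= 0 keeps w_a away from 2, and a = S_a exp w_a cannot vanish: this is why the logarithm
    of a does not branch on the tower. *)
Lemma tower_log_coord (P : term -> Prop) c a : @tower R P c -> P a -> teval base a != 0 :> R[i] ->
  2 <= normc (2 - c (Some a)) /\ teval c a != 0.
Proof.
move=> [cb cP] Pa a0; have ca := cP a Pa a0; split.
  by apply: normc_2B_ge2; apply: log_rel_Re_le0 ca; exact: bounded_teval.
by rewrite -ca -normc_gt0 normcM normc_cexp mulr_gt0 ?expR_gt0// normc_gt0 scale_neq0.
Qed.

(** Strict bounds at [c] survive for small s. A relation survives because both of its sides are
    multiplied by the same factor. So every interior point lies on a small disc of the tower
    parametrised by z. *)
Lemma lift_conf_tower L (c : option term -> R[i]) :
  let L' := [seq a <- L | teval base a != 0 :> R[i]] in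
  tower (fun a => a \in L) c -> normc (c None) < 1 ->
  (forall a, a \in L' -> normc (c (Some a)) < bound (Tlog a)) ->
  near0 (fun s => tower (fun a => a \in L) (lift_conf L' c s)).
Proof.
move=> L' ct c1 cL.
have c0 a : a \in L' -> teval c a != 0.
  by rewrite mem_filter => /andP[a0 aL]; have [] := tower_log_coord ct aL a0.
have close u (r : R) : normc (teval c u) < r -> near0 (fun s => normc (lift_val L' c s u) <= r).
  move=> ur; have h := lift_val_cvg c0 u (e := r - normc (teval c u)).
  have h1 : 0 < r - normc (teval c u) by rewrite subr_gt0.
  apply: near0_mono (h h1) _ => s hs.
  by rewrite -(subrK (teval c u) (lift_val _ _ _ _)) (le_trans (le_normcD _ _))// -lerBrDr.
have h1 : near0 (fun s => forall a, a \in L' -> normc (lift_val L' c s (Tlog a)) <= bound (Tlog a)).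
  by apply: near0_all => a aL; apply: close; exact: cL.
have h2 := near0_all (cexp_lift c0).
apply: near0_mono (near0_and (close Tvar 1 c1) (near0_and h1 h2)) _ => s [sz [sb se]].
split=> [[a|]|a aL a0] //.
  have [aL|aL] := boolP (a \in L'); first exact: sb.
  by rewrite /lift_conf /= (negbTE aL) addr0; exact: (proj1 ct (Some a)).
have aL' : a \in L' by rewrite mem_filter a0.
rewrite /log_rel teval_lift [lift_conf _ _ _ _]/(lift_val L' c s (Tlog a)) se//.
rewrite mulrAC (proj2 ct a aL a0) mulrCA divff ?mulr1//; exact: c0.
Qed.

(* Otherwise the functional of lift_not_local_max would attain its maximum in
   the interior. *)
Lemma finite_level (L : seq term) t : uniq L ->
  exists2 x : config, tower (fun a => a \in L) (coord x) &
    4^-1 <= normc (teval (coord x) t - (coord x None)^*).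
Proof.
move=> uL; apply: contrapT => H.
pose L' := [seq a <- L | teval base a != 0 :> R[i]].
have near_conj (c : option term -> R[i]) : tower (fun a => a \in L) c ->
    normc (teval c t - (c None)^*) < 4^-1.
  move=> ct; rewrite ltNge; apply/negP => ge; apply: H.
  by exists (of_coord c); rewrite of_coordK.
have uL' : uniq L' by rewrite filter_uniq.
pose A := [set x : config | tower (fun a => a \in L) (coord x)].
pose u (c : option term -> R[i]) := Re (1 - c None * teval c t)
  - \sum_(a <- L') eps a * ln (normc (2 - c (Some a))) + 4^-1 * normc (c None) ^+ 2.
have Aln (c : option term -> R[i]) a : tower (fun a => a \in L) c ->
    a \in L' -> 2 <= normc (2 - c (Some a)).
  move=> ct; rewrite mem_filter => /andP[a0 aL].
  by have [] := tower_log_coord ct aL a0.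
have Abase : tower (fun a => a \in L) (@base R).
  by split=> [|a _]; [exact: base_tower.1|exact: base_tower.2].
have [|||m mA mmax] := @compact_EVT_max _ _ (fun x => u (coord x)) A.
- by exists (of_coord base); rewrite /A /= of_coordK.
- exact: compact_tower.
- apply: continuous_in_subspaceT => x /set_mem xA.
  apply: (@continuous_log_functional R config term x (coord ^~ None) (fun y => teval (coord y) t)
     (fun a => coord ^~ (Some a)) eps 4^-1 L').
  + exact: ccontinuous_coord.
  + exact: ccontinuous_teval.
  + by move=> a; exact: ccontinuous_coord.
  + by move=> a aL; apply: lt_le_trans (Aln _ _ xA aL).
move/set_mem: mA => mA.
set c := coord m in mmax *.
have {}mA : tower (fun a => a \in L) c by [].
have {}mmax c' : tower (fun a => a \in L) c' -> u c' <= u c.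
  move=> c'A; have := mmax (of_coord c'); rewrite of_coordK; apply.
  by apply/mem_set; rewrite /A /= of_coordK.
have term_ge0 (c' : option term -> R[i]) a : tower (fun a => a \in L) c' -> a \in L' ->
    0 <= eps a * ln (normc (2 - c' (Some a))).
  move=> c'A aL; rewrite mulr_ge0 ?(ltW (eps_gt0 _)) ?ln_ge0//.
  by have := Aln _ _ c'A aL; lra.
(* Here z = 0, so u is 1 minus the logarithmic sum, which is at most the total weight 1/4. *)
have ubase : 3 / 4 <= u base.
  have S : \sum_(a <- L') eps a * ln (normc (2 - base (Some a))) <= 4^-1 :> R.
    apply: le_trans (sum_weight_le uL'); apply: ler_sum => a _; exact: eps_base_le.
  rewrite /u [base None]/(0 : R[i]) mul0r subr0 normc0 expr0n mulr0 addr0.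
  by rewrite (_ : Re 1 = 1 :> R)//; lra.
have {ubase mmax} [um cmax] := (le_trans ubase (mmax _ Abase), mmax).
pose S := \sum_(a <- L') eps a * ln (normc (2 - c (Some a))).
have S0 : 0 <= S by rewrite /S big_seq sumr_ge0// => a aL; exact: term_ge0.
(* With p = conj z + d and |d| < 1/4, Re (1 - z p) = 1 - |z|^2 - Re (z d). *)
have zle : Re (1 - c None * teval c t) <= 5 / 4 - normc (c None) ^+ 2.
  have h := near_conj c mA; set d := teval c t - _ in h.
  have -> : teval c t = (c None)^* + d by rewrite /d; ring.
  have := normr_Re_le (c None * d); rewrite normcM ler_norml => /andP[+ _].
  have zd : normc (c None) * normc d <= 4^-1.
    by have := ler_pM (normc_ge0 _) (normc_ge0 _) (mA.1 None) (ltW h); rewrite mul1r.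
  have -> : Re (1 - c None * ((c None)^* + d)) = 1 - normc (c None) ^+ 2 - Re (c None * d).
    rewrite normc_sqr; case: (c None) => p q; case: (d) => p' q' /=; ring.
  lra.
(* 3/4 <= u <= 5/4 - |z|^2 - S + |z|^2/4. This yields both |z| < 1 and S <= 1/2, so no boundary is
   reached. *)
have zS : 3 / 4 * normc (c None) ^+ 2 + S <= 2^-1.
  by move: um; rewrite /u -/S; lra.
have c1 : normc (c None) < 1 by have := normc_ge0 (c None); nra.
have cL a : a \in L' -> normc (c (Some a)) < bound (Tlog a).
  move=> aL; have e0 := @eps_gt0 R a.
  have le1 : eps a * ln (normc (2 - c (Some a))) <= S.
    rewrite /S (big_rem _ aL) lerDl big_seq sumr_ge0// => b /mem_rem bL.
    exact: term_ge0 mA bL.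
  have n2 := Aln _ _ mA aL; have n0 : 0 < normc (2 - c (Some a)) by lra.
  (* Otherwise the single summand of a would be at least 1, against S <= 1/2. As R_a = 2 + exp
     (1/eps_a), the bound |w_a| < R_a follows. *)
  have : normc (2 - c (Some a)) < expR (eps a)^-1.
    rewrite -[ltLHS]lnK// ltr_expR -(ltr_pM2l e0) divff ?gt_eqF//.
    by have := normc_ge0 (c None); nra.
  have := le_normcD 2 (- (2 - c (Some a))); rewrite normcN opprB addrC subrK.
  rewrite normc2.
  by rewrite /bound /= -/(base (Some a)) -/(eps a); lra.
apply: (@lift_not_local_max R L' c eps t 4^-1); rewrite ?invr_gt0//.
- by move=> a; rewrite mem_filter => /andP[a0 aL]; have [] := tower_log_coord mA aL a0.
- move=> a aL; apply/eqP => E; have := Aln _ _ mA aL.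
  by rewrite E subrr normc0; lra.
by apply: near0_mono (lift_conf_tower mA c1 cL) _ => s; exact: cmax.
Qed.

Lemma tower_conj_far t :
  exists2 x : config, tower setT (coord x) &
    4^-1 <= normc (teval (coord x) t - (coord x None)^*).
Proof.
have cg : ccontinuous (fun x : config => teval (coord x) t - (coord x None)^*).
  apply: ccontinuousD; first exact: ccontinuous_teval.
  by apply: ccontinuousN; apply: ccontinuous_conj; exact: ccontinuous_coord.
(* The gap inequality is closed and joins the compact set, so that only the logarithm relations
   remain to be met, finitely many at a time. *)
have cB : compact ([set x : config | bounded (coord x)] `&`
    [set x | 4^-1 <= normc (teval (coord x) t - (coord x None)^*)]).
  apply: (subclosed_compact _ compact_bounded) => [|x []//].
  apply: closedI; last exact: closed_normc_ge.
  exact: closed_bounded.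
have [|x [xb xt] xr] := compact_finI Tvar cB (@closed_log_rel R).
  move=> s us; have [x [xb xr] xt] := finite_level t us.
  by exists x => // a aL /=; exact: xr.
by exists x => //; split=> // a _; exact: xr.
Qed.

End FiniteLevel.

(** * Uniform convergence of complex functions *)

Section UniformTopology.
Context {R : realType}.

Lemma normcE (z : R[i]) : `|z| = (normc z)%:C. Proof. by []. Qed.

(** Radii in the normed space [R[i]] are complex numbers; the positive ones being real, its topology
    reduces to estimates in R. *)
Lemma pos_complex (e : R[i]) : 0 < e -> exists2 r : R, 0 < r & e = r%:C.
Proof.
rewrite ltcE /= => /andP[/eqP ie re]; exists (Re e) => //.
by case: e ie {re} => a b /= ->.
Qed.

Lemma complex_continuousP (T : topologicalType) (f : T -> R[i]) (x : T) :
  {for x, continuous f} <->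
  forall e : R, 0 < e -> \forall y \near x, normc (f x - f y) < e.
Proof.
split=> [/cvgrPdist_lt fx e e0|fx].
  have := fx e%:C; rewrite ltcR => /(_ e0).
  by apply: filterS => y; rewrite normcE ltcR.
apply/cvgrPdist_lt => _ /pos_complex[e e0 ->].
by apply: filterS (fx e e0) => y; rewrite normcE ltcR.
Qed.

Lemma ccontinuousP (T : topologicalType) (f : T -> R[i]) :
  ccontinuous f -> continuous f.
Proof.
move=> fc x; apply/complex_continuousP => e e0.
have h : normc (f x - f y) @[y --> x] --> normc (f x - f x).
  have := @continuous_normc R T _ (ccontinuousD (ccontinuous_cst (f x)) (ccontinuousN fc)).
  exact.
have /cvgrPdist_lt /(_ e e0) := h.
apply: filterS => y; rewrite subrr normc0 sub0r normrN; exact: le_lt_trans (ler_norm _).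
Qed.

Lemma closure_uniformP (X : topologicalType) (S : set {uniform X -> R[i]}) f :
  closure S f <-> forall e : R, 0 < e ->
    exists2 g, S g & forall x, normc (f x - g x) < e.
Proof.
split=> [Sf e e0|Sf B].
  have [] := Sf [set g | forall x, normc (f x - g x) < e]; last by move=> g [? ?]; exists g.
  apply/uniform_nbhs; exists [set xy | ball xy.1 e%:C xy.2]; split.
    by rewrite -entourage_ballE; exists e%:C => //=; rewrite ltcR.
  by move=> g /= h x; have := h x I; rewrite -ball_normE /= normcE ltcR.
move=> /uniform_nbhs[E [+ EB]]; rewrite -entourage_ballE => -[_/= /pos_complex[e e0 ->] eE].
have [g Sg fg] := Sf e e0; exists g; split=> //; apply: EB => x _.
by apply: eE; rewrite /= -ball_normE /= normcE ltcR.
Qed.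

End UniformTopology.

(** * The uniform algebra *)

Section TowerAlgebra.
Context {R : realType}.

Definition tower_set : set (config R) := [set x | tower setT (coord x)].

Definition tower_space : topologicalType := set_type tower_set.

Implicit Types (x y : tower_space) (f g : {uniform tower_space -> R[i]}).

Definition tcoord x : option term -> R[i] := coord (set_val x).

Lemma tcoord_tower x : tower setT (tcoord x).
Proof. by case: x => x xP; rewrite /tcoord /=; exact: (set_mem xP). Qed.

Lemma tcoord_lift c : tower setT c -> exists x, tcoord x = c.
Proof.
move=> ct; have xP : of_coord c \in tower_set by apply/mem_set; rewrite /tower_set /= of_coordK.
by exists (exist (fun m => m \in tower_set) _ xP); rewrite /tcoord set_valE /= of_coordK.
Qed.

Lemma continuous_set_val : continuous (set_val : tower_space -> config R).
Proof. exact: initial_continuous. Qed.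

(** The image filter in [config R] has a cluster point in the compact tower. Neighbourhoods in the
    subspace are traces of open sets, so that point is also a cluster point of the original
    filter. *)
Lemma compact_tower_space : compact [set: tower_space].
Proof.
move=> F FF _.
have [|p [pT pcl]] := @compact_tower R setT (set_val @ F) _.
  apply: (@filterE _ F _ (set_val @^-1` _)) => x; exact: tcoord_tower.
have xP : p \in tower_set by exact: mem_set.
exists (exist (fun m => m \in tower_set) p xP); split=> // A B FA [_ [[V oV <-] Vp VB]].
have nV : nbhs p V by apply: open_nbhs_nbhs; split.
have FsA : (set_val @ F) (set_val @` A).
  have h : A `<=` set_val @^-1` (set_val @` A) by move=> x Ax; exists x.
  exact: filterS h FA.
have [_ [[x Ax <-] Vx]] := pcl _ _ FsA nV.
by exists x; split=> //; exact: VB.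
Qed.

Lemma hausdorff_tower_space : hausdorff_space tower_space.
Proof.
move=> p q pq; apply: val_inj.
have hK : hausdorff_space (config R).
  by apply: (@hausdorff_product _ (fun=> R)) => i; exact: order_hausdorff.
apply: hK => A B nA nB.
have [x [Ax Bx]] := pq _ _ (continuous_set_val nA) (continuous_set_val nB).
by exists (set_val x).
Qed.

Lemma ccontinuous_tower t : ccontinuous (fun x => teval (tcoord x) t).
Proof.
have [h1 h2] := @ccontinuous_teval R t.
split=> x.
  exact: (@continuous_comp _ _ _ set_val (fun m => Re (teval (coord m) t)) x
    (@continuous_set_val x) (h1 _)).
exact: (@continuous_comp _ _ _ set_val (fun m => Im (teval (coord m) t)) x
  (@continuous_set_val x) (h2 _)).
Qed.

(** The uniform closure of the functions given by terms; general complex constants enter only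
    through the closure. *)
Definition tower_alg : set {uniform tower_space -> R[i]} :=
  [set f | forall e : R, 0 < e ->
     exists t, forall x, normc (f x - teval (tcoord x) t) <= e].

Lemma tower_alg_teval t : tower_alg (fun x => teval (tcoord x) t).
Proof. by move=> e e0; exists t => x; rewrite subrr normc0 ltW. Qed.

Lemma rat_approx (r e : R) : 0 < e -> exists q : rat, `|r - ratr q| <= e.
Proof.
move=> e0; have [|q] := @rat_in_itvoo R r (r + e); first by rewrite ltrDl.
rewrite in_itv/= => /andP[h1 h2]; exists q; rewrite ler_norml; apply/andP; split; lra.
Qed.

Lemma tower_alg_cst c : tower_alg (cst c).
Proof.
move=> e e0; have e2 : 0 < e / 2 by rewrite divr_gt0.
have [p pP] := rat_approx (Re c) e2; have [q qP] := rat_approx (Im c) e2.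
exists (Tcst p q) => x; apply: le_trans (normc_le_ReIm _) _.
by rewrite ReD ImD ReN ImN /=; lra.
Qed.

Lemma tower_algD f g : tower_alg f -> tower_alg g -> tower_alg (f \+ g).
Proof.
move=> fA gA e e0; have e2 : 0 < e / 2 by rewrite divr_gt0.
have [t tP] := fA _ e2; have [u uP] := gA _ e2; exists (Tadd t u) => x /=.
rewrite (_ : _ - _ = (f x - teval (tcoord x) t) + (g x - teval (tcoord x) u)); last by ring.
by apply: le_trans (le_normcD _ _) _; have := tP x; have := uP x; lra.
Qed.

Lemma normc_teval_le t x : normc (teval (tcoord x) t) <= @bound R t.
Proof. exact: bounded_teval (proj1 (tcoord_tower x)). Qed.

Lemma tower_algM f g : tower_alg f -> tower_alg g -> tower_alg (f \* g).
Proof.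
(* A crude approximation [t0] bounds f first. Then [u] is chosen for g by that bound, and finally
   [t] for f by the bound of [u]. *)
move=> fA gA e e0; have [t0 t0P] := fA 1 ltr01.
have M0 : 0 < 2 * (2 + @bound R t0) by have := @bound_ge0 R t0; lra.
have [u uP] := gA _ (divr_gt0 e0 M0).
have N0 : 0 < 2 * (2 + @bound R u) by have := @bound_ge0 R u; lra.
have [t tP] := fA _ (divr_gt0 e0 N0).
exists (Tmul t u) => x /=.
rewrite (_ : _ - _ = f x * (g x - teval (tcoord x) u)
  + teval (tcoord x) u * (f x - teval (tcoord x) t)); last by ring.
apply: le_trans (le_normcD _ _) _; rewrite !normcM.
have fb : normc (f x) <= 2 + bound t0.
  have := le_normcD (f x - teval (tcoord x) t0) (teval (tcoord x) t0); rewrite subrK.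
  by have := t0P x; have := normc_teval_le t0 x; lra.
have ub : normc (teval (tcoord x) u) <= 2 + bound u by have := normc_teval_le u x; lra.
have h1 := ler_pM (normc_ge0 _) (normc_ge0 _) fb (uP x).
have h2 := ler_pM (normc_ge0 _) (normc_ge0 _) ub (tP x).
apply: le_trans (lerD h1 h2) _.
have E (M : R) : 0 < 2 * M -> M * (e / (2 * M)) = e / 2.
  by move=> M2; field; apply/eqP => M00; move: M2; rewrite M00 mulr0 ltxx.
by rewrite !E//; lra.
Qed.

Lemma tower_alg_closed : closed tower_alg.
Proof.
move=> f /closure_uniformP fcl e e0; have e2 : 0 < e / 2 by rewrite divr_gt0.
have [g gA fg] := fcl _ e2; have [t tP] := gA _ e2; exists t => x.
rewrite -(subrK (g x) (f x)) -addrA; apply: le_trans (le_normcD _ _) _.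
by have := fg x; have := tP x; lra.
Qed.

Lemma tower_alg_cont : tower_alg `<=` @cont_funs R tower_space.
Proof.
move=> f fA x; apply/complex_continuousP => e e0; have e3 : 0 < e / 3 by rewrite divr_gt0.
have [t tP] := fA _ e3.
have /complex_continuousP /(_ _ e3) := ccontinuousP (ccontinuous_tower t) (x := x).
apply: filterS => y xy.
rewrite (_ : f x - f y = (f x - teval (tcoord x) t) + (teval (tcoord x) t - teval (tcoord y) t)
   + (teval (tcoord y) t - f y)); last by ring.
apply: le_lt_trans (le_normcD _ _) _.
have := le_normcD (f x - teval (tcoord x) t) (teval (tcoord x) t - teval (tcoord y) t).
by have := tP x; have := tP y; rewrite (normcB (f y)); lra.
Qed.

(** A point is determined by its coordinates, each of which is the value of a term. *)
Lemma tower_alg_sep x y : x <> y -> exists2 f, tower_alg f & f x <> f y.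
Proof.
move=> xy; apply: contrapT => H; apply: xy; apply: val_inj.
have E o : tcoord x o = tcoord y o.
  apply: contrapT => ne; apply: H.
  exists (fun x => teval (tcoord x) (if o is Some a then Tlog a else Tvar)).
    exact: tower_alg_teval.
  by case: o ne.
by apply/funext => -[i []]; have [] := E i.
Qed.

Lemma tower_alg_uniform : uniform_algebra tower_alg.
Proof.
split.
- exact: tower_alg_cont.
- exact: tower_alg_closed.
- exact: tower_alg_cst.
- exact: tower_algD.
- by move=> c f; apply: tower_algM; exact: tower_alg_cst.
- exact: tower_algM.
- exact: tower_alg_sep.
Qed.

Lemma tower_alg_nontrivial : nontrivial tower_alg.
Proof.
move=> E; have : @cont_funs R tower_space (fun x => (tcoord x None)^*).
  by apply: ccontinuousP; apply: ccontinuous_conj; exact: (ccontinuous_tower Tvar).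
(* An approximation within 1/8 contradicts the gap 1/4. *)
rewrite -E => /(_ 8^-1); rewrite invr_gt0 ltr0n => /(_ isT) [t tP].
have [x0 /tcoord_lift[x xE]] := @tower_conj_far R t.
by rewrite -xE; have := tP x; rewrite normcB; lra.
Qed.

(** On the whole tower t = S_t exp w_t = exp (log S_t + w_t). *)
Lemma teval_exp t : teval base t != 0 :> R[i] ->
  exp_set tower_alg (fun x => teval (tcoord x) t).
Proof.
move=> t0; exists (cst (ln (1 + bound t))%:C \+ (fun x => teval (tcoord x) (Tlog t))).
  by apply: tower_algD; [exact: tower_alg_cst|exact: tower_alg_teval].
apply/funext => x.
rewrite -[LHS]/(cexp ((ln (1 + bound t))%:C + teval (tcoord x) (Tlog t))).
rewrite cexpD cexp_real lnK ?posrE ?ltr_pwDl ?bound_ge0//.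
by rewrite mulrC; exact: (proj2 (tcoord_tower x)).
Qed.

Lemma tower_alg_exp_dense : tower_alg `<=` closure (exp_set tower_alg).
Proof.
move=> f fA; apply/closure_uniformP => e e0.
have e2 : 0 < e / 2 by rewrite divr_gt0.
have [t tP] := fA _ e2.
suff [u u0 uP] : exists2 u, teval base u != 0 :> R[i] &
    forall x, normc (teval (tcoord x) t - teval (tcoord x) u) < e / 2.
  exists (fun x => teval (tcoord x) u); first exact: teval_exp.
  move=> x; rewrite -(subrK (teval (tcoord x) t) (f x)) -addrA.
  by apply: le_lt_trans (le_normcD _ _) _; have := tP x; have := uP x; lra.
have [t0|t0] := eqVneq (teval base t) (0 : R[i]); last first.
  by exists t => // x; rewrite subrr normc0.
(* A term vanishing at the base point is shifted by a small positive rational, which becomes its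
   value there. *)
have [q] := @rat_in_itvoo R 0 (e / 2) e2; rewrite in_itv/= => /andP[q0 qe].
exists (Tadd t (Tcst q 0)) => /=; first by rewrite t0 add0r eq_complex /= gt_eqF.
move=> x; rewrite opprD addNKr normcN.
by rewrite /= raddf0 expr0n addr0 sqrtr_sqr gtr0_norm.
Qed.

End TowerAlgebra.

Theorem theorem1p6 (R : realType) :
  exists (X : topologicalType) (A : set {uniform X -> R[i]}),
    [/\ compact [set: X],
        hausdorff_space X,
        uniform_algebra A,
        nontrivial A
      & A `<=` closure (exp_set A)].
Proof.
exists tower_space, tower_alg; split.
- exact: compact_tower_space.
- exact: hausdorff_tower_space.
- exact: tower_alg_uniform.
- exact: tower_alg_nontrivial.
- exact: tower_alg_exp_dense.
Qed.
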